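(* Let $M,N,L\ge 1$ be integers with $L\ge M$ and $L\ge N$, and let $\mathbf{R}_{\mathrm T}\in\mathbb{C}^{M\times M}$ be Hermitian positive definite with eigendecomposition $\mathbf{R}_{\mathrm T}=\mathbf{U}_{\mathrm T}^{\mathsf H}\,\mathrm{diag}\{\lambda_1,\dots,\lambda_M\}\,\mathbf{U}_{\mathrm T}$ ($\mathbf{U}_{\mathrm T}$ unitary, $\lambda_m>0$). For $p_{\mathrm s}>0$ define the maximal uplink sensing rate $$\mathcal{R}_{\mathrm u,s}=\frac{N}{L}\max_{\mathbf{S}\in\mathbb{C}^{M\times L},\ \mathrm{tr}(\mathbf{S}\mathbf{S}^{\mathsf H})\le p_{\mathrm s}}\log_2\det\big(\mathbf{I}_L+\mathbf{S}^{\mathsf H}\mathbf{R}_{\mathrm T}\mathbf{S}\big).$$ Then $$\mathcal{R}_{\mathrm u,s}=\frac{N}{L}\sum_{m=1}^{M}\log_2\big(1+\lambda_m a_m^{\star}\big),\qquad a_m^{\star}=\max\Big\{0,\frac1\nu-\frac{1}{\lambda_m}\Big\},$$ where $\nu$ is determined by $\sum_{m=1}^{M}\max\{0,\frac1\nu-\frac{1}{\lambda_m}\}=p_{\mathrm s}$. The sensing rate is maximized when $\mathbf{S}\mathbf{S}^{\mathsf H}=\mathbf{U}_{\mathrm T}^{\mathsf H}\mathbf{\Theta}^{\star}\mathbf{U}_{\mathrm T}$ with $\mathbf{\Theta}^{\star}=\mathrm{diag}\{a_1^{\star},\dots,a_M^{\star}\}$. When $p_{\mathrm s}\to\infty$,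 $$\mathcal{R}_{\mathrm u,s}\approx\frac{NM}{L}\Big(\log_2 p_{\mathrm s}+\frac1M\sum_{m=1}^{M}\log_2\Big(\frac{\lambda_m}{M}\Big)\Big).$$
   Context: $(\cdot)^{\mathsf H}$ is the conjugate transpose. The symbol $\approx$ denotes a high-SNR approximation (as $p_{\mathrm s}\to\infty$), for which no explicit error term is specified. $N\log_2\det(\mathbf{I}_L+\mathbf{S}^{\mathsf H}\mathbf{R}_{\mathrm T}\mathbf{S})$ is the uplink sensing mutual information over $L$ symbols for a base station with $M$ transmit and $N$ receive antennas using radar waveform $\mathbf{S}$, after the decoded communication signals are removed; $\mathbf{R}_{\mathrm T}$ is the transmit correlation matrix of the target response and $p_{\mathrm s}$ is the sensing SNR. *)

(* Defs.v *)
From mathcomp Require Import all_boot all_order all_algebra.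
From mathcomp Require Import sesquilinear spectral.
From mathcomp Require Import all_classical all_reals all_analysis.
From mathcomp Require Export complex.

Set Implicit Arguments.
Unset Strict Implicit.
Unset Printing Implicit Defensive.

Import Order.TTheory GRing.Theory Num.Theory.
Import numFieldNormedType.Exports.
Local Open Scope classical_set_scope.
Local Open Scope ring_scope.
Local Open Scope sesquilinear_scope.
Local Open Scope complex_scope.

Section SensingRate.
Variable R : realType.

Definition log2 (x : R) : R := ln x / ln 2.

Definition diagC (n : nat) (d : 'I_n -> R) : 'M[R[i]]_n :=
  diag_mx (\row_m (d m)%:C).

(* In the order of R[i], [0 < z] also says that z is real. *)
Definition posdefmx (n : nat) (A : 'M[R[i]]_n) : Prop :=
  A \is hermsymmx /\
  forall x : 'cV[R[i]]_n, x != 0 -> 0 < (x^t* *m A *m x) 0 0.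

Definition feasible (M L : nat) (p : R) (S : 'M[R[i]]_(M, L)) : Prop :=
  \tr (S *m S^t*) <= p%:C.

(* The determinant is a positive real when RT is positive definite, so taking
   its real part loses nothing. *)
Definition logdet (M L : nat) (RT : 'M[R[i]]_M) (S : 'M[R[i]]_(M, L)) : R :=
  log2 (complex.Re (\det (1%:M + S^t* *m RT *m S))).

Definition maximizer (M L : nat) (RT : 'M[R[i]]_M) (p : R)
    (S : 'M[R[i]]_(M, L)) : Prop :=
  feasible p S /\
  forall S' : 'M[R[i]]_(M, L), feasible p S' -> logdet RT S' <= logdet RT S.

(* The supremum is the maximum as soon as a [maximizer] exists; outside that
   case [sup] may be a default value. *)
Definition sensing_rate (M N L : nat) (RT : 'M[R[i]]_M) (p : R) : R :=
  N%:R / L%:R *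
  sup [set logdet RT S | S in [set S : 'M[R[i]]_(M, L) | feasible p S]].

Definition waterfill (M : nat) (lambda : 'I_M -> R) (nu : R) (m : 'I_M) : R :=
  Num.max 0 (1 / nu - 1 / lambda m).

Definition high_snr_rate (M N L : nat) (lambda : 'I_M -> R) (p : R) : R :=
  (N * M)%:R / L%:R *
  (log2 p + 1 / M%:R * \sum_(m < M) log2 (lambda m / M%:R)).

End SensingRate.

(* Main.v *)
(** The map [P |-> ln det P] on positive semidefinite matrices lies below its
    tangents.  At the diagonal matrix of the water-filling gains
    [y_m = 1 + lambda_m a_m] this reads, for a feasible [S] and the diagonal
    entries [b_m] of [U S S^H U^H],
      [ln det (I + S^H RT S) - sum_m ln y_m
         <= sum_m ((1 + lambda_m b_m) / y_m - 1)],
    and the KKT conditions bound the right-hand side by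
    [nu * sum_m (b_m - a_m) <= 0].  This bypasses Hadamard's inequality.  Once
    [p >= M s] with [s = sum_m 1 / lambda_m], all channels are active and the
    error of the high-SNR formula is exactly [N M / L * log2 (1 + s / p)]. *)
Require Import Defs.
From mathcomp Require Import all_boot all_order all_algebra.
From mathcomp Require Import sesquilinear spectral.
From mathcomp Require Import all_classical all_reals all_analysis.
From mathcomp Require Import ring.

Set Implicit Arguments.
Unset Strict Implicit.
Unset Printing Implicit Defensive.

Import Order.TTheory GRing.Theory Num.Theory.
Import numFieldNormedType.Exports.
Local Open Scope classical_set_scope.
Local Open Scope ring_scope.
Local Open Scope sesquilinear_scope.

(** Sylvester's identity: the same two block matrices, multiplied in either order, give block
    triangular products with diagonal blocks [1 + A B, 1] and [1, 1 + B A]. *)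
Lemma det_add1_mulC (F : comNzRingType) (m n : nat)
    (A : 'M[F]_(m, n)) (B : 'M[F]_(n, m)) :
  \det (1%:M + A *m B) = \det (1%:M + B *m A).
Proof.
have E1 : block_mx 1%:M A (- B) 1%:M *m block_mx 1%:M 0 B 1%:M
    = block_mx (1%:M + A *m B) A 0 1%:M.
  by rewrite mulmx_block !mul1mx !mulmx1 !mulmx0 add0r addNr add0r.
have E2 : block_mx 1%:M 0 B 1%:M *m block_mx 1%:M A (- B) 1%:M
    = block_mx 1%:M A 0 (1%:M + B *m A).
  rewrite mulmx_block !mul1mx !mulmx1 !mul0mx !addr0 subrr.
  by rewrite [B *m A + _]addrC.
move: (congr1 determinant E1) (congr1 determinant E2).
by rewrite !det_mulmx mulrC => ->; rewrite !det_ublock !det1 mulr1 mul1r.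
Qed.

(** * Real diagonal matrices, Gram matrices and unitary conjugation *)

Section Matrices.
Variable R : realType.
Local Notation C := R[i].

Lemma trmxC_mul (m n p : nat) (A : 'M[C]_(m, n)) (B : 'M[C]_(n, p)) :
  (A *m B)^t* = B^t* *m A^t*.
Proof. by rewrite trmx_mul map_mxM. Qed.

Lemma diagC_trmxC (n : nat) (d : 'I_n -> R) : (diagC d)^t* = diagC d.
Proof.
apply/matrixP => i j; rewrite !mxE; case: (eqVneq j i) => [->|nji].
  by rewrite !mulr1n; exact: conjc_real.
by rewrite !mulr0n conjC0.
Qed.

Lemma mul_diagC (n : nat) (d e : 'I_n -> R) :
  diagC d *m diagC e = diagC (fun i => d i * e i).
Proof.
rewrite /diagC mulmx_diag; congr diag_mx.
by apply/rowP => i; rewrite !mxE rmorphM.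
Qed.

Lemma diagC_conjE (n : nat) (d : 'I_n -> R) (A : 'M[C]_n) i j :
  (diagC d *m A *m diagC d) i j = (d i)%:C%C * A i j * (d j)%:C%C.
Proof. by rewrite /diagC mul_mx_diag mxE mul_diag_mx !mxE. Qed.

Lemma det_diagC (n : nat) (d : 'I_n -> R) :
  \det (diagC d) = (\prod_i d i)%:C%C.
Proof. by rewrite det_diag rmorph_prod; apply: eq_bigr => i _; rewrite mxE. Qed.

Lemma tr_diagC (n : nat) (d : 'I_n -> R) :
  \tr (diagC d) = (\sum_i d i)%:C%C.
Proof.
by rewrite mxtrace_diag rmorph_sum; apply: eq_bigr => i _; rewrite mxE.
Qed.

Lemma diagC1 (n : nat) : diagC (fun _ : 'I_n => 1 : R) = 1%:M.
Proof. by apply/matrixP => i j; rewrite !mxE. Qed.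

Lemma diagCD (n : nat) (d e : 'I_n -> R) :
  diagC d + diagC e = diagC (fun i => d i + e i).
Proof.
rewrite /diagC -raddfD; congr diag_mx.
by apply/rowP => i; rewrite !mxE rmorphD.
Qed.

Lemma gram_diag_ge0 (m n : nat) (G : 'M[C]_(m, n)) i : 0 <= (G *m G^t*) i i.
Proof.
rewrite mxE; apply: sumr_ge0 => j _.
by rewrite !mxE mul_conjC_ge0.
Qed.

Lemma gram_diag_real (m n : nat) (G : 'M[C]_(m, n)) i :
  (G *m G^t*) i i = (complex.Re ((G *m G^t*) i i))%:C%C.
Proof. by rewrite RRe_real // ger0_real // gram_diag_ge0. Qed.

Lemma unitary_conj_det (n : nat) (U A : 'M[C]_n) : U \is unitarymx ->
  \det (U^t* *m A *m U) = \det A.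
Proof.
move=> hU; rewrite !det_mulmx mulrAC -det_mulmx.
by rewrite (mulmx1C (unitarymxP hU)) det1 mul1r.
Qed.

Lemma unitary_conj_tr (n : nat) (U A : 'M[C]_n) : U \is unitarymx ->
  \tr (U^t* *m A *m U) = \tr A.
Proof.
by move=> hU; rewrite mxtrace_mulC mulmxA (unitarymxP _) ?mul1mx.
Qed.

(* Applies [x <= expR (x - 1)] to each eigenvalue of the Gram matrix. *)
Lemma det_gram_le (m n : nat) (G : 'M[C]_(m, n)) :
  complex.Re (\det (G *m G^t*))
    <= expR (complex.Re (\tr (G *m G^t*)) - m%:R).
Proof.
set A := G *m G^t*.
have nA : A \is normalmx.
  by apply/normalmxP; rewrite /A trmxC_mul trmxCK.
have [V [d [hV EA]]] : exists (V : 'M[C]_m) (d : 'rV[C]_m),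
    V \is unitarymx /\ A = V^t* *m diag_mx d *m V.
  exists (spectralmx A), (spectral_diag A).
  have hV := spectral_unitarymx A; split => //.
  by have := elimT (@orthomx_spectralP _ _ A) nA; rewrite invmx_unitary.
(* The diagonal matrix of eigenvalues is itself a Gram matrix, so the eigenvalues are real and
   nonnegative. *)
have Ed : diag_mx d = (V *m G) *m (V *m G)^t*.
  rewrite trmxC_mul mulmxA -[V *m G *m _]mulmxA -/A EA.
  by rewrite !mulmxA (unitarymxP hV) mul1mx -mulmxA (unitarymxP hV) mulmx1.
pose e i := complex.Re (d 0 i).
have E i : d 0 i = (e i)%:C%C.
  have : diag_mx d i i = d 0 i by rewrite mxE eqxx.
  by rewrite /e => <-; rewrite Ed -gram_diag_real.
have e0 i : 0 <= e i.
  have : diag_mx d i i = d 0 i by rewrite mxE eqxx.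
  by rewrite -ler0c -E => <-; rewrite Ed gram_diag_ge0.
have Ede : d = \row_i (e i)%:C%C by apply/rowP => i; rewrite mxE E.
rewrite EA Ede -/(diagC e) unitary_conj_det // unitary_conj_tr //.
rewrite det_diagC tr_diagC /=.
have -> : \sum_i e i - m%:R = \sum_i (e i - 1).
  by rewrite sumrB sumr_const card_ord.
rewrite expR_sum; apply: ler_prod => i _; rewrite e0 /=.
by have := expR_ge1Dx (e i - 1); rewrite addrC subrK.
Qed.

End Matrices.

(** * Water-filling: power allocation and the tangent inequality *)

Section Waterfilling.
Variables (R : realType) (M : nat) (lambda : 'I_M -> R).
Hypothesis lambda_gt0 : forall m, 0 < lambda m.
Local Notation C := R[i].

Lemma log2_ge0 (x : R) : 1 <= x -> 0 <= log2 x.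
Proof. by move=> x1; rewrite divr_ge0 // ln_ge0 // ler1n. Qed.

(** Since [ln] is 0 at nonpositive arguments, [1 <= y] spares a positivity proof for [x], which will
    be the real part of a determinant. *)
Lemma log2_le (x y : R) : 1 <= y -> x <= y -> log2 x <= log2 y.
Proof.
move=> y1 xy; have y0 : 0 < y := lt_le_trans ltr01 y1.
have [x0|x0] := ltP 0 x; last first.
  by rewrite [X in X <= _]/log2 ln0 // mul0r log2_ge0.
rewrite ler_pM2r ?invr_gt0 ?ln_gt0 ?ltr1n //.
by rewrite ler_ln ?posrE.
Qed.

Lemma log2_prod (I : finType) (F : I -> R) :
  (forall i, 0 < F i) -> log2 (\prod_i F i) = \sum_i log2 (F i).
Proof.
move=> F0; rewrite /log2 -mulr_suml; congr (_ / _).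
suff [_ ->] : 0 < \prod_i F i /\ ln (\prod_i F i) = \sum_i ln (F i) by [].
apply: (big_rec2 (fun x y => 0 < x /\ ln x = y)) => [|i y1 y2 _ [p0 <-]].
  by rewrite ltr01 ln1.
by rewrite mulr_gt0 // lnM ?posrE.
Qed.

Lemma waterfill_ge0 nu m : 0 <= waterfill lambda nu m.
Proof. by rewrite le_max lexx. Qed.

Lemma gain_ge1 nu m : 1 <= 1 + lambda m * waterfill lambda nu m.
Proof. by rewrite lerDl mulr_ge0 ?waterfill_ge0 // ltW. Qed.

Lemma gain_gt0 nu m : 0 < 1 + lambda m * waterfill lambda nu m.
Proof. exact: lt_le_trans ltr01 (gain_ge1 nu m). Qed.

(* The KKT conditions: the marginal gain is [nu] on active channels and at most
   [nu] on the others, so the tangent at the optimum has slope at most [nu]. *)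
Lemma waterfill_tangent nu m (b : R) : 0 < nu -> 0 <= b ->
  (1 + lambda m * b) / (1 + lambda m * waterfill lambda nu m) - 1
    <= nu * (b - waterfill lambda nu m).
Proof.
move=> nu0 b0; have l0 := lambda_gt0 m; rewrite /waterfill !div1r.
case: (leP 0 (nu^-1 - (lambda m)^-1)) => h.
  have -> : 1 + lambda m * (nu^-1 - (lambda m)^-1) = lambda m / nu.
    by field; rewrite !gt_eqF.
  rewrite le_eqVlt; apply/orP; left; apply/eqP.
  by field; rewrite !gt_eqF.
(* An inactive channel has gain 1, and inactivity means [lambda m < nu]. The active case above is an
   equality. *)
rewrite mulr0 addr0 divr1 subr0 addrC addKr ler_wpM2r //.
by move: h; rewrite subr_lt0 ltf_pV2 ?posrE // => /ltW.
Qed.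

(** Intermediate value theorem in the water level [t = 1 / nu], in which the total power is
    continuous down to [t = 0]. *)
Lemma waterfill_exists (p : R) : (0 < M)%N -> 0 < p ->
  exists2 nu : R, 0 < nu & \sum_m waterfill lambda nu m = p.
Proof.
move=> hM p0.
pose g (t : R) := \sum_m Num.max 0 (t - 1 / lambda m).
have gc : continuous g.
  apply: continuous_big => [|m _ x]; first exact: add_continuous.
  apply: (@continuous_max _ _ (fun=> 0) (fun t : R => t - 1 / lambda m)).
    exact: cvg_cst.
  by apply: cvgB; [exact: cvg_id|exact: cvg_cst].
have g0 : g 0 = 0.
  rewrite /g big1 // => m _; apply/max_idPl.
  by rewrite sub0r oppr_le0 divr_ge0 // ltW.
pose m0 : 'I_M := Ordinal hM.
(* At this level channel [m0] alone already receives power [p]. *)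
pose b := p + 1 / lambda m0.
have b0 : 0 <= b by rewrite addr_ge0 ?divr_ge0 // ltW.
have gb : p <= g b.
  rewrite /g (bigD1 m0) //= -[X in X <= _]addr0 lerD //.
    by rewrite /b addrK le_max lexx orbT.
  by apply: sumr_ge0 => m _; rewrite le_max lexx.
have [||t] := @IVT R g 0 b p b0.
- exact: continuous_subspaceT.
- by rewrite g0 ge_min le_max (ltW p0) gb orbT.
rewrite in_itv /= => /andP[t0 _] gt.
have {}t0 : 0 < t.
  rewrite lt_def t0 andbT; apply: contra_eq_neq gt => ->.
  by rewrite g0 lt_eqF.
exists t^-1; first by rewrite invr_gt0.
by rewrite -gt /g; apply: eq_bigr => m _; rewrite /waterfill div1r invrK.
Qed.

(** A higher water level lowers no power and strictly raises that of any channel active at the lower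
    level; such a channel exists because [p] is positive. *)
Lemma waterfill_unique (nu nu' p : R) : 0 < p -> 0 < nu -> 0 < nu' ->
  \sum_m waterfill lambda nu m = p -> \sum_m waterfill lambda nu' m = p ->
  nu' = nu.
Proof.
move=> p0; wlog: nu nu' / nu < nu' => [wl|lt] nu0 nu'0 h h'.
  have [e|e|//] := ltgtP nu' nu; last exact: wl.
  by apply/esym; exact: (wl nu' nu).
suff : \sum_m waterfill lambda nu' m < \sum_m waterfill lambda nu m.
  by rewrite h h' ltxx.
have i : nu'^-1 < nu^-1 by rewrite ltf_pV2 ?posrE.
have le m : waterfill lambda nu' m <= waterfill lambda nu m.
  by rewrite /waterfill !div1r ge_max !le_max lexx /= lerD2r (ltW i) orbT.
have [m a0] : exists m, 0 < waterfill lambda nu' m.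
  apply/existsP; apply: contraLR (p0); rewrite -h' => /existsPn H.
  by rewrite -leNgt; apply: sumr_le0 => m _; rewrite leNgt.
rewrite (bigD1 m) //= [ltRHS](bigD1 m) //= ltr_leD //; last exact: ler_sum.
move: a0; rewrite /waterfill !div1r !lt_max ltxx /= => a0.
by rewrite (max_idPr (ltW a0)) ltrD2r i orbT.
Qed.

(** Without truncation the power constraint gives [1 / nu = (p + s) / M], where [s] is the sum of
    the [1 / lambda m]. For [p >= M s] this level is at least [s], hence at least each
    [1 / lambda m], so no truncation occurs. *)
Lemma waterfill_full (nu p : R) : (0 < M)%N ->
  nu = M%:R / (p + \sum_m 1 / lambda m) ->
  M%:R * \sum_m 1 / lambda m <= p -> 0 < p ->
  [/\ 0 < nu, \sum_m waterfill lambda nu m = p &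
      forall m, 1 + lambda m * waterfill lambda nu m = lambda m / nu].
Proof.
move=> hM nuE; set s := \sum_m _ in nuE *; move=> hp p0.
have M0 : 0 < M%:R :> R by rewrite ltr0n.
have s0 : 0 <= s by apply: sumr_ge0 => m _; rewrite divr_ge0 // ltW.
have ps0 : 0 < p + s by rewrite ltr_wpDr.
have nu0 : 0 < nu by rewrite nuE divr_gt0.
have W m : waterfill lambda nu m = 1 / nu - 1 / lambda m.
  apply/max_idPr; rewrite subr_ge0 (@le_trans _ _ s) //.
    rewrite /s (bigD1 m) //= lerDl sumr_ge0 // => j _.
    by rewrite divr_ge0 // ltW.
  by rewrite nuE div1r invf_div ler_pdivlMr // mulrC (le_trans hp) // lerDl.
split=> // [|m].
  under eq_bigr do rewrite W.
  rewrite sumrB sumr_const card_ord -/s -mulr_natl nuE.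
  by field; rewrite !gt_eqF.
by rewrite W; field; rewrite !gt_eqF.
Qed.

(** The tangent inequality in exponential form: [det_gram_le] applied to the block row [[I, W]],
    with [W] the rows of [T] scaled by [sqrt (lambda m)], after scaling row [m] by
    [1 / sqrt (y m)]. *)
Lemma det_tangent_le (L : nat) (T : 'M[C]_(M, L)) (y : 'I_M -> R) :
  (forall m, 0 < y m) ->
  complex.Re (\det (1%:M + T^t* *m diagC lambda *m T)) <=
  \prod_m y m *
  expR (\sum_m ((1 + lambda m * complex.Re ((T *m T^t*) m m)) / y m - 1)).
Proof.
move=> y0.
pose b m := complex.Re ((T *m T^t*) m m).
have bE m : (T *m T^t*) m m = (b m)%:C%C := gram_diag_real T m.
pose r m := Num.sqrt (lambda m).
pose W := diagC r *m T.
pose q m := (Num.sqrt (y m))^-1.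
(* The identity block makes [I + W W^H] a Gram matrix. *)
pose H := row_mx 1%:M W.
have HH : H *m H^t* = 1%:M + W *m W^t*.
  by rewrite /H tr_row_mx map_col_mx mul_row_col trmx1 map_mx1 mulmx1.
have rr : diagC r *m diagC r = diagC lambda.
  rewrite mul_diagC (_ : (fun m => _) = lambda) //.
  by apply/funext => m; rewrite -expr2 sqr_sqrtr // ltW.
have WW : W^t* *m W = T^t* *m diagC lambda *m T.
  by rewrite /W trmxC_mul diagC_trmxC mulmxA -(mulmxA (T^t*)) rr.
have detHH : \det (H *m H^t*) = \det (1%:M + T^t* *m diagC lambda *m T).
  by rewrite HH det_add1_mulC WW.
have GG : (diagC q *m H) *m (diagC q *m H)^t*
    = diagC q *m (H *m H^t*) *m diagC q.
  by rewrite trmxC_mul diagC_trmxC !mulmxA.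
have detG : complex.Re (\det ((diagC q *m H) *m (diagC q *m H)^t*))
    = complex.Re (\det (1%:M + T^t* *m diagC lambda *m T)) / \prod_m y m.
  rewrite GG det_mulmx [\det (diagC q *m _)]det_mulmx detHH mulrAC -det_mulmx.
  rewrite mul_diagC det_diagC mulrC.
  have -> : \prod_i (q i * q i) = (\prod_m y m)^-1.
    rewrite -prodfV; apply: eq_bigr => m _.
    by rewrite -invfM -expr2 sqr_sqrtr // ltW.
  by case: (\det _) => u v /=; rewrite mulr0 subr0.
have trG : \tr ((diagC q *m H) *m (diagC q *m H)^t*)
    = (\sum_m (1 + lambda m * complex.Re ((T *m T^t*) m m)) / y m)%:C%C.
  have WE : W *m W^t* = diagC r *m (T *m T^t*) *m diagC r.
    by rewrite /W trmxC_mul diagC_trmxC !mulmxA.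
  rewrite GG HH WE rmorph_sum; apply: eq_bigr => m _.
  rewrite -/(b m) diagC_conjE 2!mxE eqxx diagC_conjE bE.
  have -> : lambda m = r m * r m by rewrite -expr2 sqr_sqrtr // ltW.
  have -> : (y m)^-1 = q m * q m.
    by rewrite -invfM -expr2 sqr_sqrtr // ltW.
  by rewrite !rmorphM rmorphD rmorph1 !rmorphM; ring.
have p0 : 0 < \prod_m y m by exact: prodr_gt0.
rewrite mulrC -ler_pdivrMr // -detG sumrB sumr_const card_ord.
by apply: le_trans (det_gram_le _) _; rewrite trG.
Qed.

(** * Optimal waveforms, the sensing rate and its high-SNR limit *)

Section Rate.
Variables (L : nat) (RT U : 'M[C]_M).
Hypothesis unitaryU : U \is unitarymx.
Hypothesis eigRT : RT = U^t* *m diagC lambda *m U.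

(** By Sylvester's identity [logdet] depends on [S] only through [S S^H], which [U] diagonalizes
    together with [RT]. *)
Lemma logdet_gram (a : 'I_M -> R) (S : 'M[C]_(M, L)) :
  (forall m, 0 < 1 + lambda m * a m) ->
  S *m S^t* = U^t* *m diagC a *m U ->
  logdet RT S = \sum_m log2 (1 + lambda m * a m).
Proof.
move=> a0 hS; rewrite /logdet -mulmxA det_add1_mulC -mulmxA hS eigRT.
have UU : U *m U^t* = 1%:M by exact/unitarymxP.
have UU' : U^t* *m U = 1%:M by exact/mulmx1C.
have -> : 1%:M + U^t* *m diagC lambda *m U *m (U^t* *m diagC a *m U)
    = U^t* *m diagC (fun m => 1 + lambda m * a m) *m U.
  rewrite -diagCD -mul_diagC diagC1 mulmxDr mulmxDl mulmx1 UU' !mulmxA.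
  by rewrite -[_ *m U *m U^t*]mulmxA UU mulmx1.
by rewrite unitary_conj_det // det_diagC /= log2_prod.
Qed.

Lemma logdet_le_waterfill nu p (S : 'M[C]_(M, L)) : 0 < nu ->
  \sum_m waterfill lambda nu m = p -> feasible p S ->
  logdet RT S <= \sum_m log2 (1 + lambda m * waterfill lambda nu m).
Proof.
move=> nu0 hnu hS; set a := waterfill lambda nu in hnu *.
pose y m := 1 + lambda m * a m.
have y0 m : 0 < y m := gain_gt0 nu m.
have y1 m : 1 <= y m := gain_ge1 nu m.
(* Rotating by [U] makes the correlation matrix diagonal and preserves the trace, so the power
   budget bounds the sum of the [b m]. *)
pose T := U *m S.
pose b m := complex.Re ((T *m T^t*) m m).
have b0 m : 0 <= b m by rewrite -ler0c -gram_diag_real gram_diag_ge0.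
have sum_b : \sum_m b m <= p.
  have : \tr (T *m T^t*) = \tr (S *m S^t*).
    rewrite trmxC_mul mulmxA mxtrace_mulC !mulmxA.
    by rewrite (mulmx1C (unitarymxP unitaryU)) mul1mx.
  have -> : \tr (T *m T^t*) = (\sum_m b m)%:C%C.
    by rewrite rmorph_sum; apply: eq_bigr => m _; exact: gram_diag_real.
  by move=> E; move: hS; rewrite /feasible -E lecR.
have -> : logdet RT S
    = log2 (complex.Re (\det (1%:M + T^t* *m diagC lambda *m T))).
  by rewrite /logdet /T trmxC_mul eigRT !mulmxA.
have prod1 : 1 <= \prod_m y m.
  by elim/big_rec: _ => // m x _ x1; exact: mulr_ege1.
rewrite -log2_prod //; apply: log2_le => //.
apply: le_trans (det_tangent_le _ y0) _.
rewrite -[leRHS]mulr1 ler_pM2l ?(lt_le_trans ltr01 prod1) //.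
rewrite -[leRHS]expR0 ler_expR.
(* The exponent is nonpositive: the [a m] spend exactly [p], the [b m] at most [p]. *)
apply: (@le_trans _ _ (\sum_m nu * (b m - a m))).
  by apply: ler_sum => m _; exact: waterfill_tangent nu0 (b0 m).
by rewrite -mulr_sumr sumrB hnu pmulr_rle0 // subr_le0.
Qed.

Lemma waterfill_maximizer nu p (S : 'M[C]_(M, L)) : 0 < nu ->
  \sum_m waterfill lambda nu m = p ->
  S *m S^t* = U^t* *m diagC (waterfill lambda nu) *m U -> maximizer RT p S.
Proof.
move=> nu0 hnu hS; split.
  by rewrite /feasible hS unitary_conj_tr // tr_diagC hnu.
move=> S' hS'; rewrite (logdet_gram _ hS); last by move=> m; exact: gain_gt0.
exact: logdet_le_waterfill hS'.
Qed.

(** The witness is [U^H D E], with [D] the diagonal square root and [E = [I, 0]], whose [M] rows of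
    length [L] are orthonormal since [M <= L]. *)
Lemma exists_gram (a : 'I_M -> R) : (M <= L)%N -> (forall m, 0 <= a m) ->
  exists S : 'M[C]_(M, L), S *m S^t* = U^t* *m diagC a *m U.
Proof.
move=> hML a0.
have [D [DC DD]] : exists D : 'M[C]_M, D^t* = D /\ D *m D = diagC a.
  exists (diagC (fun m => Num.sqrt (a m))); split; first exact: diagC_trmxC.
  rewrite mul_diagC (_ : (fun m => _) = a) //.
  by apply/funext => m; rewrite -expr2 sqr_sqrtr.
have [E EE] : exists E : 'M[C]_(M, L), E *m E^t* = 1%:M.
  by exists (pid_mx M); rewrite tr_pid_mx map_pid_mx pid_mx_id // pid_mx_1.
exists (U^t* *m D *m E).
by rewrite !trmxC_mul trmxCK DC -!mulmxA (mulmxA E) EE mul1mx (mulmxA D) DD.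
Qed.

Lemma sensing_rate_waterfill (N : nat) nu p : (M <= L)%N -> 0 < nu ->
  \sum_m waterfill lambda nu m = p ->
  sensing_rate N L RT p =
  N%:R / L%:R * \sum_m log2 (1 + lambda m * waterfill lambda nu m).
Proof.
move=> hML nu0 hnu; congr (_ * _).
have [S hS] := exists_gram hML (waterfill_ge0 nu).
have [fS _] := waterfill_maximizer nu0 hnu hS.
set A := [set _ | _ in _]; set v := \sum_m _.
have Av : A v.
  exists S => //; rewrite (logdet_gram _ hS) // => m; exact: gain_gt0.
have uA : ubound A v.
  by move=> _ [S' fS' <-]; exact: logdet_le_waterfill fS'.
(* The value [v] is attained and bounds the set, so the set is nonempty and bounded and [sup] is not
   a default value. *)
apply/eqP; rewrite eq_le; apply/andP; split.
  by apply: ge_sup => //; exists v.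
by apply: ub_le_sup => //; exists v.
Qed.

(** Each gain factors as [(lambda m / M) * p * (1 + s / p)]. The first two factors produce the
    high-SNR formula; the third, common to all channels, is the error. *)
Lemma sensing_rate_high_snr (N : nat) p : (0 < M)%N -> (M <= L)%N -> 0 < p ->
  M%:R * \sum_m 1 / lambda m <= p ->
  sensing_rate N L RT p - high_snr_rate N L lambda p =
  (N * M)%:R / L%:R * log2 (1 + (\sum_m 1 / lambda m) / p).
Proof.
move=> hM hML p0 hp; have [nu0 hnu gE] := waterfill_full hM erefl hp p0.
rewrite (sensing_rate_waterfill N hML nu0 hnu) /high_snr_rate.
set nu := _ / _ in nu0 hnu gE *; set s := \sum_m _ in hp nu nu0 hnu gE *.
have M0 : 0 < M%:R :> R by rewrite ltr0n.
have L0 : 0 < L%:R :> R by rewrite ltr0n (leq_trans hM).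
have s0 : 0 <= s by apply: sumr_ge0 => m _; rewrite divr_ge0 // ltW.
have ps0 : 0 < 1 + s / p by rewrite ltr_wpDr // divr_ge0 // ltW.
have E m : log2 (1 + lambda m * waterfill lambda nu m)
    = log2 (lambda m / M%:R) + (log2 p + log2 (1 + s / p)).
  rewrite gE (_ : _ / nu = lambda m / M%:R * (p * (1 + s / p))); last first.
    rewrite /nu; field.
    by rewrite !gt_eqF // ltr_wpDr.
  rewrite /log2 -!mulrDl lnM ?posrE ?divr_gt0 ?mulr_gt0 //.
  by rewrite [ln (p * _)]lnM ?posrE.
under eq_bigr do rewrite E.
rewrite big_split /= sumr_const card_ord -mulr_natl natrM.
by field; rewrite !gt_eqF.
Qed.

(** The approximation is read as a difference tending to 0. Eventually the exact error formula
    applies, and [ln] is continuous at 1. *)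
Lemma sensing_rate_asymptotic (N : nat) : (0 < M)%N -> (M <= L)%N ->
  (sensing_rate N L RT p - high_snr_rate N L lambda p) @[p --> +oo] --> (0 : R).
Proof.
move=> hM hML; set s := \sum_m 1 / lambda m.
have near_eq : \forall p \near +oo,
    (N * M)%:R / L%:R * log2 (1 + s / p) =
    sensing_rate N L RT p - high_snr_rate N L lambda p.
  apply: filterS2 (nbhs_pinfty_gt (num_real (0 : R)))
    (nbhs_pinfty_ge (num_real (M%:R * s))) => p p0 ps.
  exact/esym/sensing_rate_high_snr.
suff : (N * M)%:R / L%:R * log2 (1 + s / p) @[p --> +oo] --> (0 : R).
  exact: cvg_trans (near_eq_cvg near_eq).
have inv0 : p^-1 @[p --> +oo] --> (0 : R).
  by apply/gtr0_cvgV0; [exact: nbhs_pinfty_gt|exact: cvg_id].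
have arg : 1 + s / p @[p --> +oo] --> (1 : R).
  rewrite -[X in _ --> X]addr0; apply: cvgD; first exact: cvg_cst.
  by rewrite -[X in _ --> X](mulr0 s); exact: cvgM (cvg_cst _) inv0.
have lim : ln (1 + s / p) @[p --> +oo] --> (0 : R).
  rewrite -(ln1 R); apply: continuous_cvg arg.
  exact: continuous_ln.
rewrite -[X in _ --> X](mulr0 ((N * M)%:R / L%:R)); apply: cvgM.
  exact: cvg_cst.
by rewrite -[X in _ --> X](mul0r (ln 2)^-1); exact: cvgM lim (cvg_cst _).
Qed.

End Rate.
End Waterfilling.

Theorem theorem6 (R : realType) (M N L : nat)
    (hM : (1 <= M)%N) (hN : (1 <= N)%N) (hL : (1 <= L)%N)
    (hML : (M <= L)%N) (hNL : (N <= L)%N)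
    (RT U : 'M[R[i]]_M) (lambda : 'I_M -> R)
    (hRT : posdefmx RT)
    (hU : U \is unitarymx)
    (hlambda : forall m : 'I_M, 0 < lambda m)
    (heig : RT = U^t* *m diagC lambda *m U) :
  (forall p : R, 0 < p ->
     exists nu : R,
       [/\ 0 < nu /\ \sum_(m < M) waterfill lambda nu m = p,
           forall nu' : R, 0 < nu' ->
             \sum_(m < M) waterfill lambda nu' m = p -> nu' = nu,
           sensing_rate N L RT p =
             N%:R / L%:R *
             \sum_(m < M) log2 (1 + lambda m * waterfill lambda nu m),
           exists S : 'M[R[i]]_(M, L),
             S *m S^t* = U^t* *m diagC (waterfill lambda nu) *m U
         & forall S : 'M[R[i]]_(M, L),
             S *m S^t* = U^t* *m diagC (waterfill lambda nu) *m U ->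
             maximizer RT p S]) /\
  (sensing_rate N L RT p - high_snr_rate N L lambda p) @[p --> +oo] --> (0 : R).
Proof.
split; last exact: (sensing_rate_asymptotic hlambda hU heig).
move=> p p0; have [nu nu0 hnu] := waterfill_exists hlambda hM p0.
exists nu; split; first by split.
- by move=> nu' nu'0 /(waterfill_unique p0 nu0 nu'0 hnu).
- exact: (sensing_rate_waterfill hlambda hU heig N hML nu0 hnu).
- exact: (exists_gram U hML (waterfill_ge0 lambda nu)).
- by move=> S /(waterfill_maximizer hlambda hU heig nu0 hnu).
Qed.
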